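(* Let $n\ge 1$ be an integer and let $L_2,\dots,L_n$ be arbitrary Kripke-complete normal unimodal propositional logics, and let $L=\mathbf{T}\times L_2\times\dots\times L_n$. Then $L$ is exponentially embeddable into its own one-variable fragment: there is a translation $f$ from $n$-modal formulas to $n$-modal formulas containing at most one propositional variable, computable in time bounded by an exponential in the length of the input formula, such that for every $n$-modal formula $\varphi$, $\varphi\in L \iff f(\varphi)\in L$.
   Context: The $n$-modal language has countably many propositional variables, the constant $\perp$, connectives $\wedge,\vee,\to$, and unary modal operators $\Box_1,\dots,\Box_n$ (with $\neg\varphi=\varphi\to\perp$, $\Diamond_i=\neg\Box_i\neg$). An $n$-frame is $\langle W,R_1,\dots,R_n\rangle$ with $W\neq\emptyset$ and binary relations $R_i$ on $W$; truth under a valuation is standard, with $\Box_i$ interpreted via $R_i$. A formula is valid in a frame if it is true at every point under every valuation; $L(\mathcal C)$ is the set of formulas valid in all frames of class $\mathcal C$, and a logic is Kripke complete if it equals $L(\mathcal C)$ for some nonempty class $\mathcal C$. $\mathbf{T}$ is the logic of all reflexive 1-frames. The product of 1-frames $\mathfrak F_i=\langle W_i,R_i\rangle$ is the $n$-frame $\langle W_1\times\dots\times W_n,\bar R_1,\dots,\bar R_n\rangle$ where $\langle x_1,\dots,x_n\rangle\bar R_i\langle y_1,\dots,y_n\rangle$ iff $x_iR_iy_i$ and $x_k=y_k$ for all $k\neq i$. For Kripke-complete unimodal logics $L_1,\dots,L_n$, the product logic $L_1\times\dots\times L_n$ is the set of $n$-modal formulas valid in all products $\mathfrak F_1\times\dots\times\mathfrak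 F_n$ with each $\mathfrak F_i$ a frame validating $L_i$. The one-variable fragment of a logic is the set of its formulas containing at most one propositional variable. *)

(* Defs.v *)
From Corelib Require Import PosDef.
From mathcomp Require Import all_boot.

Set Implicit Arguments.
Unset Strict Implicit.
Unset Printing Implicit Defensive.

(** * Modal formulas *)

(* The modalities Box_1, ..., Box_n are indexed by 'I_n, so Box_1 has index 0. *)
Inductive form (n : nat) : Type :=
| Var of nat
| Bot
| And of form n & form n
| Or of form n & form n
| Imp of form n & form n
| Box of 'I_n & form n.

Arguments Var {n}.
Arguments Bot {n}.

Fixpoint vars (n : nat) (phi : form n) : seq nat :=
  match phi with
  | Var p => [:: p]
  | Bot => [::]
  | And a b | Or a b | Imp a b => vars a ++ vars b
  | Box _ a => vars a
  end.

Definition at_most_one_var (n : nat) (phi : form n) : Prop :=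
  size (undup (vars phi)) <= 1.

(** * Kripke semantics *)

Record frame (n : nat) := Frame {
  world :> Type;
  rel_of : 'I_n -> world -> world -> Prop;
  world_inhabited : inhabited world
}.

Fixpoint sat (n : nat) (F : frame n) (V : nat -> F -> Prop) (x : F)
    (phi : form n) : Prop :=
  match phi with
  | Var p => V p x
  | Bot => False
  | And a b => sat V x a /\ sat V x b
  | Or a b => sat V x a \/ sat V x b
  | Imp a b => sat V x a -> sat V x b
  | Box i a => forall y : F, rel_of i x y -> sat V y a
  end.

Definition valid (n : nat) (F : frame n) (phi : form n) : Prop :=
  forall (V : nat -> F -> Prop) (x : F), sat V x phi.

Definition logic (n : nat) := form n -> Prop.

Definition logic_of (n : nat) (C : frame n -> Prop) : logic n :=
  fun phi => forall F : frame n, C F -> valid F phi.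

(* Every logic of this kind is a normal modal logic. *)
Definition kripke_complete (n : nat) (L : logic n) : Prop :=
  exists C : frame n -> Prop,
    (exists F, C F) /\ (forall phi, L phi <-> logic_of C phi).

Definition validates (n : nat) (F : frame n) (L : logic n) : Prop :=
  forall phi, L phi -> valid F phi.

Definition reflexive_frame (F : frame 1) : Prop :=
  forall x : F, rel_of ord0 x x.

Definition logic_T : logic 1 := logic_of reflexive_frame.

(** * Products *)

Section Product.
Variables (n : nat) (F : 'I_n -> frame 1).

Definition prod_world : Type := forall i : 'I_n, F i.

Definition prod_rel (i : 'I_n) (x y : prod_world) : Prop :=
  rel_of ord0 (x i) (y i) /\ forall k : 'I_n, k != i -> x k = y k.

Lemma prod_world_inhabited : inhabited prod_world.
Proof.
have H (i : 'I_n) : exists u : F i, True.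
  by case: (world_inhabited (F i)) => u; exists u.
by have [x _] := fin_all_exists H; constructor.
Qed.

Definition prod_frame : frame n := Frame prod_rel prod_world_inhabited.

End Product.

Definition product_logic (n : nat) (L : 'I_n -> logic 1) : logic n :=
  fun phi => forall F : 'I_n -> frame 1,
    (forall i, validates (F i) (L i)) -> valid (prod_frame F) phi.

(** * Formulas as words over a finite alphabet *)

Inductive token (n : nat) : Type :=
| TVar | TDigit of bool | TBot | TAnd | TOr | TImp | TBox of 'I_n.

Arguments TVar {n}.
Arguments TDigit {n}.
Arguments TBot {n}.
Arguments TAnd {n}.
Arguments TOr {n}.
Arguments TImp {n}.

(* Binary digits, least significant first; 0 has no digits. *)
Fixpoint pos_digits (p : positive) : seq bool :=
  match p with
  | xH => [:: true]
  | xO q => false :: pos_digits q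
  | xI q => true :: pos_digits q
  end.

Definition digits (k : nat) : seq bool :=
  if bin_of_nat k is Npos p then pos_digits p else [::].

(* Polish notation: connectives and modalities have a fixed arity, and the
   digits of a variable index end at the first token that is not a digit, so
   no parentheses or separators are needed. *)
Fixpoint encode (n : nat) (phi : form n) : seq (token n) :=
  match phi with
  | Var p => TVar :: map TDigit (digits p)
  | Bot => [:: TBot]
  | And a b => TAnd :: encode a ++ encode b
  | Or a b => TOr :: encode a ++ encode b
  | Imp a b => TImp :: encode a ++ encode b
  | Box i a => TBox i :: encode a
  end.

(** * Deterministic multi-tape Turing machines *)

(* A cell holds [option S], with [None] the blank.  [tleft] lists the cells to
   the left of the head, nearest first; cells beyond either list are blank. *)
Record tape (S : Type) := Tape {
  tleft : seq (option S);
  thead : option S;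
  tright : seq (option S)
}.

Inductive move := MoveL | MoveN | MoveR.

Definition write_move (S : Type) (a : option S * move) (t : tape S) : tape S :=
  match a.2 with
  | MoveN => Tape (tleft t) a.1 (tright t)
  | MoveL => Tape (behead (tleft t)) (head None (tleft t)) (a.1 :: tright t)
  | MoveR => Tape (a.1 :: tleft t) (head None (tright t)) (behead (tright t))
  end.

(* The machine has [k.+1] tapes; the input is on the first one and the output
   is on the last one. *)
Record machine (S : finType) (k : nat) := Machine {
  state : finType;
  start : state;
  halting : pred state;
  delta : state -> {ffun 'I_k.+1 -> option S} ->
          state * {ffun 'I_k.+1 -> option S * move}
}.

Section Run.
Variables (S : finType) (k : nat) (M : machine S k).

Definition config : Type := (state M * ('I_k.+1 -> tape S))%type.

Definition step (c : config) : config :=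
  if halting c.1 then c else
  let d := delta c.1 [ffun j => thead (c.2 j)] in
  (d.1, fun j => write_move (d.2 j) (c.2 j)).

Definition blank_tape : tape S := Tape [::] None [::].

Definition input_tape (w : seq S) : tape S :=
  if w is a :: w' then Tape [::] (Some a) (map Some w') else blank_tape.

Definition init (w : seq S) : config :=
  (start M, fun j => if j == ord0 then input_tape w else blank_tape).

(* Up to blank cells, the tape contains exactly [w], with the head on the first
   symbol of [w]. *)
Definition tape_holds (t : tape S) (w : seq S) : Prop :=
  exists i j : nat, tleft t = nseq i None /\
    thead t :: tright t = map Some w ++ nseq j None.

Definition computes_within (w w' : seq S) (b : nat) : Prop :=
  exists t : nat, t <= b /\
    let c := iter t step (init w) in
    halting c.1 /\ tape_holds (c.2 ord_max) w'.

End Run.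

(* [emb] embeds the tokens into the tape alphabet, which may contain further
   auxiliary symbols. *)
Definition computable_in_exp_time (n : nat) (f : form n -> form n) : Prop :=
  exists (S : finType) (k : nat) (M : machine S k) (emb : token n -> S) (c : nat),
    injective emb /\
    forall phi : form n,
      computes_within M (map emb (encode phi)) (map emb (encode (f phi)))
        (2 ^ (c * size (encode phi) + c)).

(* Main.v *)
(** The translation substitutes for the variable [p_k] a formula [alpha_k] in one
    variable [p] and the first modality; substitution instances of members of
    the logic are members.  Conversely, given a model on
    [F_1 x ... x F_n], every point [x] of the reflexive frame [F_1] is blown up
    into a gadget of cells, with the same frame but a row-dependent valuation of
    [p], so that [alpha_k] holds at every cell of [x] exactly where [p_k] held at
    [x].  From every cell one may pass to the cell [Entry] of any successor of
    [x], so the blown-up frame is reflexive and maps p-morphically onto [F_1].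
    Cells are told apart by their rank, the distance to a cell where [p] fails;
    since transitivity is not required, ranks are definable, and foreign gadgets
    are seen only through cells of the top rank 5, hence do not disturb the
    reading.  A gadget contains a binary tree, and [alpha_k] descends along the
    binary digits of [k] and reads a bit there.  As [alpha_k] is built digit by
    digit, a finite-state transducer computes the translation on Polish words. *)

From Stdlib Require Import FunctionalExtensionality Classical_Prop.
From HB Require Import structures.
Require Import Defs.
From mathcomp Require Import all_boot zify.

Set Implicit Arguments.
Unset Strict Implicit.
Unset Printing Implicit Defensive.

(** * The translation: one variable, preservation of membership *)

Section Translation.
Variables (n : nat) (i0 : 'I_n).

Definition neg (a : form n) : form n := Imp a Bot.

Definition boxp (j : nat) : form n := iter j (Box i0) (Var 0).

(** Over a reflexive relation [boxp j] says that [p] holds up to distance [j], so this fixes the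
    distance to the nearest failure of [p]. *)
Definition rank_form (j : nat) : form n :=
  if j is j'.+1 then And (boxp j') (neg (boxp j)) else neg (Var 0).

(** Boxes suffice, as each intended successor is the only one of the required rank. Since [a] occurs
    once and last, its Polish word merely receives a fixed prefix. *)
Fixpoint descend (j : nat) (a : form n) : form n :=
  Box i0 (Imp (rank_form j) (if j is j'.+1 then descend j' a else a)).

Definition bit_form : form n := neg (Box i0 (neg (rank_form 1))).

(* The rank of the topmost cell of the chain leading to the tree node [s]; it
   tells left children, right children and the root apart. *)
Definition top (s : seq bool) : nat :=
  if s is b :: _ then (if b then 2 else 3) else 4.

Definition path_form (s : seq bool) : form n :=
  foldr (fun b => descend (top [:: b])) bit_form s.

Definition var_form (k : nat) : form n := descend (top [::]) (path_form (digits k)).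

Fixpoint translate (phi : form n) : form n :=
  match phi with
  | Var k => var_form k
  | Bot => Bot
  | And a b => And (translate a) (translate b)
  | Or a b => Or (translate a) (translate b)
  | Imp a b => Imp (translate a) (translate b)
  | Box i a => Box i (translate a)
  end.

Lemma sat_translate (F : frame n) (V : nat -> F -> Prop) (phi : form n) (x : F) :
  sat V x (translate phi) <-> sat (fun k y => sat V y (var_form k)) x phi.
Proof.
elim: phi x => //=.
- by move=> a IHa b IHb x; rewrite IHa IHb.
- by move=> a IHa b IHb x; rewrite IHa IHb.
- by move=> a IHa b IHb x; rewrite IHa IHb.
- by move=> i a IHa x; split=> H y /H /IHa.
Qed.

Lemma product_logic_translate (L_ : 'I_n -> logic 1) (phi : form n) :
  product_logic L_ phi -> product_logic L_ (translate phi).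
Proof. by move=> H F FL V x; apply/sat_translate/H. Qed.

Lemma vars_boxp (j : nat) : vars (boxp j) = [:: 0].
Proof. by elim: j. Qed.

Lemma vars_rank_form (j : nat) : all (pred1 0) (vars (rank_form j)).
Proof. by case: j => //= j; rewrite !cats0 all_cat -/(boxp j) !vars_boxp. Qed.

Lemma vars_descend (j : nat) (a : form n) :
  all (pred1 0) (vars a) -> all (pred1 0) (vars (descend j a)).
Proof.
move=> Ha; elim: j => [|j IHj] //=.
by rewrite all_cat IHj -/(rank_form j.+1) (vars_rank_form j.+1).
Qed.

Lemma vars_translate (phi : form n) : all (pred1 0) (vars (translate phi)).
Proof.
elim: phi => //= [k|a IHa b IHb|a IHa b IHb|a IHa b IHb]; last 3 first.
- by rewrite all_cat IHa.
- by rewrite all_cat IHa.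
- by rewrite all_cat IHa.
apply: (@vars_descend 4); elim: (digits k) => //= b s IHs.
exact: vars_descend.
Qed.

Lemma translate_at_most_one_var (phi : form n) : at_most_one_var (translate phi).
Proof.
rewrite /at_most_one_var; have /all_pred1P -> := vars_translate phi.
apply: (@uniq_leq_size _ _ [:: 0]); first exact: undup_uniq.
by move=> k; rewrite mem_undup mem_nseq inE => /andP[].
Qed.

End Translation.

(** * Gadget cells and their ranks *)

(* [Node s j] is the cell of rank [j] on the chain that ends at the tree node
   [Node s 0]; for [j > top s] it is a junk cell of rank 5.  [p] holds at [Bit s]
   according to the value stored at [s]. *)
Inductive cell := Entry | Node of seq bool & nat | Bit of seq bool.

(** The edges to the root, of rank 4, keep every rank at most 5; [own_back] gives [Bit s] rank 1
    when [p] holds there. *)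
Inductive own : cell -> cell -> Prop :=
| own_refl c : own c c
| own_root c : own c (Node [::] (top [::]))
| own_down s j : j < top s -> own (Node s j.+1) (Node s j)
| own_child s b : own (Node s 0) (Node (b :: s) (top [:: b]))
| own_bit s : own (Node s 0) (Bit s)
| own_back s : own (Bit s) (Node s 0).

Definition node_rank (s : seq bool) (j : nat) : nat := if j <= top s then j else 5.

(** Closed form for the truth of [boxp j] at [c]; [P] holds of the tree nodes storing a true bit. *)
Definition rank_above (P : seq bool -> Prop) (c : cell) (j : nat) : Prop :=
  match c with
  | Entry => j < 5
  | Node s i => j < node_rank s i
  | Bit s => j = 0 /\ P s
  end.

Definition rank_is (P : seq bool -> Prop) (c : cell) (j : nat) : Prop :=
  match c with
  | Entry => j = 5
  | Node s i => j = node_rank s i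
  | Bit s => match j with 0 => ~ P s | 1 => P s | _ => False end
  end.

Lemma top_le4 (s : seq bool) : top s <= 4.
Proof. by case: s => [|[] s]. Qed.

Lemma node_rank_le5 (s : seq bool) (j : nat) : node_rank s j <= 5.
Proof. by rewrite /node_rank; case: ifP => // /leq_trans/(_ (top_le4 s))/leqW. Qed.

(** This mirrors the truth clause of [Box]: [j < 5] is the contribution of the [Entry] successors,
    of rank 5. *)
Lemma rank_aboveS (P : seq bool -> Prop) (c : cell) (j : nat) :
  rank_above P c j.+1 <->
  (forall c', own c c' -> rank_above P c' j) /\ j < 5.
Proof.
split=> [H|[H _]].
  have j4 : j < 4.
    by case: c H => [|s i|s] //= => [|[]//]; have := node_rank_le5 s i; lia.
  split; last lia.
  move=> c' Hc; case: Hc H => //= {c c'}.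
  - by move=> [|s i|s] /=; [lia|lia|case].
  - by move=> s i ilt; rewrite /node_rank ilt (ltnW ilt); lia.
  - by move=> s [].
(* The edge to the root settles [Entry] and the junk cells. *)
have j4 : j < 4 := H _ (own_root _).
case: c H => [//|s i|s] H /=.
- rewrite /node_rank; case: (leqP i (top s)) => [Hi|_ //].
  case: i H Hi => [|i] H Hi.
    by have /= := H _ (own_refl _).
  by have /= := H _ (own_down Hi); rewrite /node_rank (ltnW Hi); lia.
- by have /= := H _ (own_back s).
Qed.

Lemma rank_isP (P : seq bool -> Prop) (c : cell) (j : nat) :
  rank_is P c j <->
  (if j is j'.+1 then rank_above P c j' /\ ~ rank_above P c j
   else ~ rank_above P c 0).
Proof.
by case: c => [|s i|s] /=; case: j => [|[|j]] /=; intuition lia.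
Qed.

(** [top s] is 4 only for the root, so no other cell has rank 4. *)
Lemma own_root_unique (P : seq bool -> Prop) (c c' : cell) :
  own c c' -> rank_is P c' 4 -> c' = Node [::] 4.
Proof.
case=> {c c'} //=.
- move=> [|s i|s] //=; rewrite /node_rank; case: leqP => // Hi i4; subst i.
  by case: s Hi => [|[] s].
- by move=> s j jlt; have := top_le4 s; rewrite /node_rank (ltnW jlt); lia.
- by move=> s [].
Qed.

Lemma own_down_unique (P : seq bool -> Prop) (s : seq bool) (j : nat) (c' : cell) :
  j < top s -> own (Node s j.+1) c' -> rank_is P c' j -> c' = Node s j.
Proof.
move=> jlt Hc; inversion Hc; subst => //=.
  by rewrite /node_rank jlt; lia.
by have := top_le4 s; move=> ? ; have -> : node_rank [::] 4 = 4 by []; lia.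
Qed.

Lemma own_child_unique (P : seq bool -> Prop) (s : seq bool) (b : bool) (c' : cell) :
  own (Node s 0) c' -> rank_is P c' (top [:: b]) ->
  c' = Node (b :: s) (top [:: b]).
Proof.
move=> Hc; inversion Hc as [| | |s' b'| |]; clear Hc; subst => //=; try by case: b.
by case: b'; case: b.
Qed.

(** * Blown-up frames *)

Section ExtendedFrame.
Variable F : frame 1.

Lemma ext_world_inhabited : inhabited (F * cell).
Proof. by case: (world_inhabited F) => x; constructor; exact: (x, Entry). Qed.

Definition gadget_rel (i : 'I_1) (u v : F * cell) : Prop :=
  (u.1 = v.1 /\ own u.2 v.2) \/ (rel_of ord0 u.1 v.1 /\ v.2 = Entry).

(* The other factors also get the coordinate [cell], as disjoint copies: this
   only serves to give all factors of the product the same shape. *)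
Definition copies_rel (i : 'I_1) (u v : F * cell) : Prop :=
  rel_of i u.1 v.1 /\ u.2 = v.2.

Definition ext_frame (b : bool) : frame 1 :=
  Frame (if b then gadget_rel else copies_rel) ext_world_inhabited.

Lemma ext_frame_reflexive : reflexive_frame (ext_frame true).
Proof. by move=> u; left; split=> //; exact: own_refl. Qed.

Lemma sat_copies (V : nat -> ext_frame false -> Prop) (phi : form 1)
    (x : F) (c : cell) :
  @sat 1 (ext_frame false) V (x, c) phi <->
  sat (fun k y => V k (y, c)) x phi.
Proof.
elim: phi x => //=.
- by move=> a IHa b IHb x; rewrite IHa IHb.
- by move=> a IHa b IHb x; rewrite IHa IHb.
- by move=> a IHa b IHb x; rewrite IHa IHb.
- move=> i a IHa x; split=> H.
    by move=> y xy; apply/IHa/H.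
  by case=> y d [/= xy <-]; apply/IHa/H.
Qed.

Lemma copies_validates (L : logic 1) :
  validates F L -> validates (ext_frame false) L.
Proof. by move=> FL phi Lphi V [x c]; apply/sat_copies/FL. Qed.

End ExtendedFrame.

Definition digits_val (s : seq bool) : nat := foldr (fun (b : bool) m => b + m.*2) 0 s.

Lemma digitsK : cancel digits digits_val.
Proof.
move=> k; rewrite -[RHS]bin_of_natK /digits; case: (bin_of_nat k) => //=.
by elim=> //= p ->; rewrite NatTrec.doubleE.
Qed.

(** * Evaluating the translation in the blown-up product *)

Section Gadget.
Variables (n : nat) (i0 : 'I_n) (F : 'I_n -> frame 1).
Variable V : nat -> prod_frame F -> Prop.
Hypothesis F_refl : reflexive_frame (F i0).

Definition extended (i : 'I_n) : frame 1 := ext_frame (F i) (i == i0).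

Local Notation W := (prod_world extended).

Definition base (w : W) : prod_world F := fun i => (w i).1.

Definition at_cell (w : W) (c : cell) : W :=
  fun i => ((w i).1, if i == i0 then c else (w i).2).

(* Children are consed, so [s] lists the digits in reverse order. *)
Definition stored (w : W) (s : seq bool) : Prop := V (digits_val (rev s)) (base w).

Definition gadget_val (k : nat) (w : prod_frame extended) : Prop :=
  rank_above (stored w) (w i0).2 0.

Local Notation gsat := (@sat n (prod_frame extended) gadget_val).

Lemma at_cell_cell (w : W) (c : cell) : (at_cell w c i0).2 = c.
Proof. by rewrite /at_cell eqxx. Qed.

Lemma at_cell_at_cell (w : W) (c d : cell) : at_cell (at_cell w c) d = at_cell w d.
Proof.
by apply: functional_extensionality_dep => i; rewrite /at_cell /=; case: (i == i0).
Qed.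

Lemma rel_extended0 (w w' : W) :
  @rel_of _ (prod_frame extended) i0 w w' <->
  (exists2 c, own (w i0).2 c & w' = at_cell w c) \/
  (@rel_of _ (prod_frame F) i0 (base w) (base w') /\ w' = at_cell w' Entry /\
    forall i, i != i0 -> w i = w' i).
Proof.
have surj (u : W) i : u i = ((u i).1, (u i).2) by case: (u i).
rewrite /= /prod_rel {1}/extended /= eqxx; split.
- case=> [[[E O]|[E Ew]] H].
    left; exists (w' i0).2 => //; apply: functional_extensionality_dep => i.
    rewrite /at_cell; case: eqP => [->|/eqP ne]; first by rewrite E -surj.
    by rewrite -surj H.
  right; split; [split=> // i ne|split].
  + by rewrite /base H.
  + apply: functional_extensionality_dep => i.
    by rewrite /at_cell; case: eqP => [->|_]; rewrite -?Ew -surj.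
  + exact: H.
- case=> [[c O ->]|[[E _] [Ew H]]]; split=> //.
  + by left; rewrite /at_cell eqxx.
  + by move=> i /negbTE ne; rewrite /at_cell ne -surj.
  + by right; split=> //; rewrite Ew at_cell_cell.
Qed.

Lemma gsat_Box (a : form n) (w : W) :
  gsat w (Box i0 a) <->
  forall w', @rel_of _ (prod_frame extended) i0 w w' -> gsat w' a.
Proof. by []. Qed.

Lemma gsat_boxp (j : nat) (w : W) :
  gsat w (boxp i0 j) <-> rank_above (stored w) (w i0).2 j.
Proof.
elim: j w => [//|j IHj] w; rewrite rank_aboveS.
rewrite -[boxp i0 j.+1]/(Box i0 (boxp i0 j)) gsat_Box; split=> [H|[H j5] w'].
- have Hown c : own (w i0).2 c -> rank_above (stored w) c j.
    move=> O; have : gsat (at_cell w c) (boxp i0 j).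
      by apply: H; apply/rel_extended0; left; exists c.
    by rewrite IHj at_cell_cell.
  (* By reflexivity the [Entry] cell over the same base point is a successor; it yields [j < 5]. *)
  split=> //; have /IHj : gsat (at_cell w Entry) (boxp i0 j).
    apply: H; apply/rel_extended0; right; split; first by split.
    split=> [|i /negbTE ne]; first by rewrite at_cell_at_cell.
    by rewrite /at_cell ne; case: (w i).
  by rewrite at_cell_cell.
- move=> /rel_extended0 [[c O ->]|[_ [-> _]]]; apply/IHj.
    by rewrite at_cell_cell; exact: H.
  by rewrite at_cell_cell.
Qed.

Lemma gsat_rank_form (j : nat) (w : W) :
  gsat w (rank_form i0 j) <-> rank_is (stored w) (w i0).2 j.
Proof.
rewrite rank_isP; case: j => [//|j].
by have A := gsat_boxp j w; have B := gsat_boxp j.+1 w; split=> -[/A ? C]; split=> // /B.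
Qed.

(** Foreign gadgets are seen at rank 5, above [top s], so the guards discard them; inside the gadget
    the last hypothesis forces the first move and [own_down_unique] the later ones. *)
Lemma gsat_descend (s : seq bool) (j : nat) (a : form n) (w : W) :
  j <= top s -> own (w i0).2 (Node s j) ->
  (forall c, own (w i0).2 c -> rank_is (stored w) c j -> c = Node s j) ->
  gsat w (descend i0 j a) <-> gsat (at_cell w (Node s 0)) a.
Proof.
elim: j w => [|j IHj] w jle O U.
  split=> [H|H w'].
    apply: H; first by apply/rel_extended0; left; exists (Node s 0).
    by apply/(gsat_rank_form 0); rewrite at_cell_cell.
  move=> /rel_extended0 [[c Oc ->]|[_ [-> _]]] /(gsat_rank_form 0).
    by rewrite at_cell_cell => /(U _ Oc) ->.
  by rewrite at_cell_cell.
have step : gsat (at_cell w (Node s j.+1)) (descend i0 j a) <->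
            gsat (at_cell w (Node s 0)) a.
  rewrite -(at_cell_at_cell w (Node s j.+1) (Node s 0)); apply: IHj; first exact: ltnW.
  - by rewrite at_cell_cell; exact: own_down.
  - by move=> c; rewrite at_cell_cell; exact: own_down_unique.
rewrite -step; split=> [H|H w'].
  apply: H; first by apply/rel_extended0; left; exists (Node s j.+1).
  by apply/(gsat_rank_form j.+1); rewrite at_cell_cell /= /node_rank jle.
move=> /rel_extended0 [[c Oc ->]|[_ [-> _]]] /(gsat_rank_form j.+1).
  by rewrite at_cell_cell => /(U _ Oc) ->.
by rewrite at_cell_cell /= => - []; have := top_le4 s; lia.
Qed.

(** Among the successors of [Node s 0] only [Bit s] can have rank 1; its rank is 0 if the stored bit
    is false. *)
Lemma gsat_bit_form (w : W) (s : seq bool) :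
  gsat (at_cell w (Node s 0)) (bit_form i0) <-> stored w s.
Proof.
split=> [H|H B].
  apply: NNPP => nP; apply: H => w'.
  move=> /rel_extended0 [[c Oc ->]|[_ [-> _]]] /(gsat_rank_form 1).
    rewrite !at_cell_cell in Oc *.
    by inversion Oc as [| | |? [] | |]; subst.
  by rewrite at_cell_cell.
apply: (B (at_cell w (Bit s))).
  apply/rel_extended0; left; exists (Bit s); last by rewrite at_cell_at_cell.
  by rewrite at_cell_cell; exact: own_bit.
by apply/(gsat_rank_form 1); rewrite at_cell_cell.
Qed.

Lemma gsat_path_form (ds s : seq bool) (w : W) :
  gsat (at_cell w (Node s 0)) (path_form i0 ds) <-> stored w (catrev ds s).
Proof.
elim: ds s => [|b ds IHds] s; first exact: gsat_bit_form.
rewrite -[catrev _ _]/(catrev ds (b :: s)) -IHds.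
rewrite -(at_cell_at_cell w (Node s 0) (Node (b :: s) 0)); apply: gsat_descend => //.
- by rewrite at_cell_cell; exact: own_child.
- by move=> c; rewrite at_cell_cell; exact: own_child_unique.
Qed.

Lemma gsat_var_form (k : nat) (w : W) : gsat w (var_form i0 k) <-> V k (base w).
Proof.
have -> : V k (base w) = stored w (catrev (digits k) [::]).
  by rewrite /stored -/(rev _) revK digitsK.
rewrite -gsat_path_form; apply: gsat_descend => //; first exact: own_root.
by move=> c; exact: own_root_unique.
Qed.

Lemma gsat_translate (phi : form n) (w : W) :
  gsat w (translate i0 phi) <-> sat V (base w) phi.
Proof.
elim: phi w => //=.
- by move=> k w; exact: gsat_var_form.
- by move=> a IHa b IHb w; rewrite IHa IHb.
- by move=> a IHa b IHb w; rewrite IHa IHb.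
- by move=> a IHa b IHb w; rewrite IHa IHb.
move=> i a IHa w; split=> H.
- move=> y [wy yE].
  (* Lifts a base step: direction [i0] lands in [Entry], any other direction keeps all cells. *)
  pose w' : W := fun k =>
    (y k, if k == i then (if i == i0 then Entry else (w i).2) else (w k).2).
  apply/(IHa w')/H; split.
    rewrite /w' /extended /= eqxx; case: eqP => _; first by right.
    by split.
  move=> k ne; have := yE k ne; rewrite /w' /base (negbTE ne) => <-.
  by case: (w k).
- move=> w' [ww' wE]; apply/IHa/H; split; last by move=> k /wE; rewrite /base => ->.
  move: ww'; rewrite /extended /base /=; case: eqP => [Ei|_]; last by case.
  (* A move inside a gadget fixes the base point, so it projects to a loop. *)
  by case=> [[-> _]|[]//]; rewrite Ei; exact: F_refl.
Qed.

End Gadget.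

(** * From the translation back to the formula *)

Lemma validates_logic_T (F : frame 1) : validates F logic_T -> reflexive_frame F.
Proof.
move=> FT x.
have := FT (Imp (Box ord0 (Var 0)) (Var 0)) _ (fun _ z => rel_of ord0 x z) x.
by apply=> // G Grefl V y; apply; exact: Grefl.
Qed.

(** Refutations lift to the blown-up product: its factor [i0] is reflexive, and every other factor
    is a disjoint union of copies of a frame for its logic. *)
Lemma translate_product_logic (n : nat) (i0 : 'I_n) (L_ : 'I_n -> logic 1)
    (phi : form n) :
  (forall psi, L_ i0 psi <-> logic_T psi) ->
  product_logic L_ (translate i0 phi) -> product_logic L_ phi.
Proof.
move=> LT H F FL V x.
have F_refl : reflexive_frame (F i0).
  by apply: validates_logic_T => psi /LT; exact: FL.
pose w : prod_world (extended i0 F) := fun i => (x i, Entry).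
apply/(gsat_translate V F_refl phi w)/H => i.
rewrite /extended; case: eqP => [->|_]; last exact/copies_validates/FL.
by move=> psi /LT; apply; exact: ext_frame_reflexive.
Qed.

(** * Tokens as a finite alphabet *)

Section TokenFinite.
Variable n : nat.

Definition token_code (a : token n) : option (option (option (option (option (bool + 'I_n))))) :=
  match a with
  | TVar => None
  | TBot => Some None
  | TAnd => Some (Some None)
  | TOr => Some (Some (Some None))
  | TImp => Some (Some (Some (Some None)))
  | TDigit b => Some (Some (Some (Some (Some (inl b)))))
  | TBox i => Some (Some (Some (Some (Some (inr i)))))
  end.

Definition token_decode (c : option (option (option (option (option (bool + 'I_n)))))) : token n :=
  match c with
  | None => TVar
  | Some None => TBot
  | Some (Some None) => TAnd
  | Some (Some (Some None)) => TOr
  | Some (Some (Some (Some None))) => TImp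
  | Some (Some (Some (Some (Some (inl b))))) => TDigit b
  | Some (Some (Some (Some (Some (inr i))))) => TBox i
  end.

Lemma token_codeK : cancel token_code token_decode.
Proof. by case. Qed.

End TokenFinite.

HB.instance Definition _ (n : nat) := Finite.copy (token n) (can_type (@token_codeK n)).

(** * Running a transducer on a two-tape machine *)

Section Transducer.
Variable T : finType.
Variables (Q : finType) (q0 : Q).
(* Reading [a] in state [q] emits [out q a]; the end of the input emits [fin q]. *)
Variables (next : Q -> T -> Q) (out : Q -> T -> seq T) (fin : Q -> seq T).

Fixpoint transduce (q : Q) (w : seq T) : seq T :=
  if w is a :: w' then out q a ++ transduce (next q a) w' else fin q.

(** Bounds every single emission, so that pending output fits into the finite control. *)
Definition out_bound : nat :=
  maxn (\max_(q : Q) \max_(a : T) size (out q a)) (\max_(q : Q) size (fin q)).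

Lemma size_out (q : Q) (a : T) : size (out q a) <= out_bound.
Proof.
apply: leq_trans (leq_maxl _ _).
exact: leq_trans (leq_bigmax (F := fun a => size (out q a)) a)
                 (leq_bigmax (F := fun q => \max_a size (out q a)) q).
Qed.

Lemma size_fin (q : Q) : size (fin q) <= out_bound.
Proof.
exact: leq_trans (leq_bigmax (F := fun q => size (fin q)) q) (leq_maxr _ _).
Qed.

Lemma size_transduce (q : Q) (w : seq T) :
  size (transduce q w) <= out_bound * (size w).+1.
Proof.
elim: w q => [|a w IHw] q /=; first by rewrite muln1 size_fin.
by rewrite size_cat mulnS leq_add ?size_out.
Qed.

(* [Some (Some (Some q))] reads in state [q]; after the last output symbol,
   [Some (Some None)] makes the first step back, [Some None] goes back to the
   first blank on the left, and [None] halts.  In every mode the symbols of the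
   buffer are written first. *)
Definition mode : Type := option (option (option Q)).

Definition tstate : Type := (out_bound.-bseq T * mode)%type.

Definition buffer (s : seq T) : out_bound.-bseq T := insub_bseq out_bound s.

Lemma bufferK (s : seq T) : size s <= out_bound -> buffer s = s :> seq T.
Proof. by move=> sz; rewrite /buffer /insub_bseq insubdK. Qed.

Definition tdelta (st : tstate) (x y : option T) :
    tstate * (option T * move) * (option T * move) :=
  match st.1 : seq T, st.2 with
  | a :: s, m => (buffer s, m, (x, MoveN), (Some a, MoveR))
  | [::], Some (Some (Some q)) =>
      if x is Some a then (buffer (out q a), Some (Some (Some (next q a))),
                           (x, MoveR), (y, MoveN))
      else (buffer (fin q), Some (Some None), (x, MoveN), (y, MoveN))
  | [::], Some (Some None) =>
      (buffer [::], Some None, (x, MoveN), (y, MoveL))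
  | [::], Some None =>
      if y is Some _ then (buffer [::], Some None, (x, MoveN), (y, MoveL))
      else (buffer [::], None, (x, MoveN), (y, MoveR))
  | [::], None => (st, (x, MoveN), (y, MoveN))
  end.

Definition tmachine : machine T 1 :=
  @Machine T 1 (out_bound.-bseq T * mode)%type (buffer [::], Some (Some (Some q0)))
    (fun st => st.2 == None)
    (fun st h =>
       let r := tdelta st (h ord0) (h ord_max) in
       (r.1.1, [ffun j => if j == ord0 then r.1.2 else r.2])).

Definition tconfig : Type := (tstate * tape T * tape T)%type.

Definition tstep (c : tconfig) : tconfig :=
  if c.1.1.2 == None then c else
  let r := tdelta c.1.1 (Defs.thead c.1.2) (Defs.thead c.2) in
  (r.1.1, write_move r.1.2 c.1.2, write_move r.2 c.2).

Definition represents (c : tconfig) (d : config tmachine) : Prop :=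
  [/\ d.1 = c.1.1, d.2 ord0 = c.1.2 & d.2 ord_max = c.2].

Lemma represents_iter (k : nat) (c : tconfig) (d : config tmachine) :
  represents c d -> represents (iter k tstep c) (iter k (@step T 1 tmachine) d).
Proof.
move=> cd; elim: k => //= k; move: (iter k _ c) (iter k _ d) => {c cd} {}c {}d [E1 E2 E3].
rewrite /step /tstep /= E1; case: ifP => // _.
by split=> /=; rewrite !ffunE /= ?E2 ?E3.
Qed.

Definition in_tape (l : seq (option T)) (w : seq T) : tape T :=
  Tape l (ohead w) (map Some (behead w)).

Definition out_tape (w : seq T) : tape T := Tape (map Some (rev w)) None [::].

(** The output tape on the way back: [r] runs leftwards from the head, [s] has been passed, and the
    last [None] is the blank where the return began. *)
Definition back_tape (r s : seq T) : tape T :=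
  Tape (map Some (behead r)) (ohead r) (rcons (map Some s) None).

Lemma write_stay (t : tape T) : write_move (Defs.thead t, MoveN) t = t.
Proof. by case: t. Qed.

Lemma iter_flush (s : seq T) (m : mode) (t : tape T) (o : seq T) :
  size s <= out_bound -> m != None ->
  iter (size s) tstep (buffer s, m, t, out_tape o) =
  (buffer [::], m, t, out_tape (o ++ s)).
Proof.
move=> + m0; elim: s o => [|a s IHs] o sz /=; first by rewrite cats0.
rewrite -iterS iterSr {2}/tstep /= (negbTE m0) /tdelta bufferK //=.
rewrite write_stay.
rewrite -[write_move _ _]/(Tape (Some a :: map Some (rev o)) None [::]).
have -> : Some a :: map Some (rev o) = map Some (rev (rcons o a)) by rewrite rev_rcons.
by rewrite [iter _ _ _]IHs ?cat_rcons // ltnW.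
Qed.

(** Each input symbol, and the end of the input, costs one reading step and at most [out_bound]
    writing steps. *)
Lemma iter_read (w : seq T) (q : Q) (l : seq (option T)) (o : seq T) :
  exists k l', k <= (out_bound.+1) * (size w).+1 /\
    iter k tstep (buffer [::], Some (Some (Some q)), in_tape l w, out_tape o) =
    (buffer [::], Some (Some None), in_tape l' [::], out_tape (o ++ transduce q w)).
Proof.
elim: w q l o => [|a w IHw] q l o.
  exists (size (fin q)).+1, l; split; first by rewrite muln1 ltnS size_fin.
  rewrite iterSr {2}/tstep /= /tdelta bufferK //=.
  exact: iter_flush (size_fin q) _.
have [k [l' [kle E]]] := IHw (next q a) (Some a :: l) (o ++ out q a).
exists (k + (size (out q a)).+1), l'; split.
  by rewrite [size (_ :: _)]/= mulnS addnC leq_add // ltnS size_out.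
rewrite iterD iterSr {3}/tstep /= /tdelta bufferK //=.
have -> : write_move (Some a, MoveR) (in_tape l (a :: w)) = in_tape (Some a :: l) w.
  by case: w {IHw E kle}.
by rewrite [iter _ _ (_, out_tape o)]iter_flush ?size_out // E catA.
Qed.

Lemma iter_back (r s : seq T) (t : tape T) :
  iter (size r) tstep (buffer [::], Some None, t, back_tape r s) =
  (buffer [::], Some None, t, back_tape [::] (catrev r s)).
Proof.
elim: r s => // a r IHr s.
rewrite [size _]/= iterSr {2}/tstep /= /tdelta bufferK //=.
rewrite write_stay.
have -> : write_move (Some a, MoveL) (back_tape (a :: r) s) = back_tape r (a :: s).
  by case: r {IHr}.
exact: IHr.
Qed.

Lemma tmachine_computes (w : seq T) :
  computes_within tmachine w (transduce q0 w)
    ((out_bound.+1) * (size w).+1 + (out_bound * (size w).+1).+2).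
Proof.
have [k [l [kle E]]] := iter_read w q0 [::] [::].
set o := transduce q0 w in E *.
(* After reading: one step off the final blank, one per output symbol back, and one to the right to
   halt. *)
exists ((size (rev o)).+2 + k); split.
  by rewrite addnC leq_add // !ltnS size_rev size_transduce.
have R0 : represents (buffer [::], Some (Some (Some q0)), in_tape [::] w, out_tape [::])
            (init tmachine w).
  by split=> //; rewrite /init /=; case: w {E o kle}.
have {}E : iter ((size (rev o)).+2 + k) tstep
    (buffer [::], Some (Some (Some q0)), in_tape [::] w, out_tape [::]) =
    (buffer [::], None, in_tape l [::], write_move (None, MoveR) (back_tape [::] o)).
  rewrite iterD E iterS iterSr {3}/tstep /= /tdelta bufferK //=.
  rewrite -[write_move (None, MoveN) _]/(in_tape l [::]).
  have -> : write_move (None, MoveL) (out_tape o) = back_tape (rev o) [::].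
    by rewrite /out_tape /back_tape; case: (rev o).
  by rewrite iter_back -/(rev _) revK /tstep /= /tdelta bufferK.
have [E1 _ E3] := represents_iter ((size (rev o)).+2 + k) R0.
rewrite E /= in E1 E3.
split; first by rewrite /= E1.
exists 1, 1; rewrite E3 /write_move /back_tape /=; split=> //.
by rewrite -cats1; case: (map Some o).
Qed.

End Transducer.

(** * The translation as a transducer on Polish words *)

Section TranslateWords.
Variables (n : nat) (i0 : 'I_n).

Fixpoint descend_word (j : nat) : seq (token n) :=
  [:: TBox i0, TImp & encode (rank_form i0 j)] ++
  (if j is j'.+1 then descend_word j' else [::]).

Lemma encode_descend (j : nat) (a : form n) :
  encode (descend i0 j a) = descend_word j ++ encode a.
Proof.
elim: j => [|j IHj]; first by [].
rewrite -[encode (descend _ _ _)]/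
  ([:: TBox i0, TImp & encode (rank_form i0 j.+1)] ++ encode (descend i0 j a)).
by rewrite IHj catA.
Qed.

Definition is_digit (a : token n) : bool := if a is TDigit _ then true else false.

(* The state tells whether the input read so far ends with a variable, whose
   index may have further digits. *)
Definition in_var (q : bool) (a : token n) : bool :=
  match a with TVar | TDigit _ => true | _ => false end.

(** The innermost [bit_form] is emitted only once the variable index is known to have ended. *)
Definition var_end (q : bool) : seq (token n) :=
  if q then encode (bit_form i0) else [::].

Definition translate_out (q : bool) (a : token n) : seq (token n) :=
  match a with
  | TDigit b => descend_word (top [:: b])
  | TVar => var_end q ++ descend_word (top [::])
  | _ => var_end q ++ [:: a]
  end.

Local Notation tr := (transduce in_var translate_out var_end).

Lemma tr_var_end (w : seq (token n)) :
  ~~ is_digit (head TBot w) -> tr true w = var_end true ++ tr false w.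
Proof. by case: w => [|[|b| | | | |i] w] //=; rewrite ?cats0 -?catA. Qed.

Lemma head_encode (phi : form n) (w : seq (token n)) :
  ~~ is_digit (head TBot (encode phi ++ w)).
Proof. by case: phi. Qed.

(** The condition on [w] keeps a variable ending [phi] from absorbing further digits. *)
Lemma tr_encode_cat (phi : form n) (w : seq (token n)) :
  ~~ is_digit (head TBot w) ->
  tr false (encode phi ++ w) = encode (translate i0 phi) ++ tr false w.
Proof.
elim: phi w => [k||a IHa b IHb|a IHa b IHb|a IHa b IHb|i a IHa] w Hw //.
- rewrite [translate _ _]/= /var_form encode_descend -catA.
  rewrite -[LHS]/(descend_word (top [::]) ++ tr true (map TDigit (digits k) ++ w)).
  congr (_ ++ _).
  elim: (digits k) => [|b s IHs]; first exact: tr_var_end.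
  rewrite -[path_form i0 (b :: s)]/(descend i0 (top [:: b]) (path_form i0 s)).
  by rewrite encode_descend -catA -IHs.
- by rewrite /= -!catA IHa ?head_encode // IHb.
- by rewrite /= -!catA IHa ?head_encode // IHb.
- by rewrite /= -!catA IHa ?head_encode // IHb.
- by rewrite /= IHa.
Qed.

Lemma tr_encode (phi : form n) : tr false (encode phi) = encode (translate i0 phi).
Proof. by rewrite -[encode phi]cats0 tr_encode_cat //= cats0. Qed.

Lemma translate_exp_time : computable_in_exp_time (translate i0).
Proof.
pose B := out_bound translate_out var_end.
exists (token n : finType), 1, (tmachine false in_var translate_out var_end), id.
(* For input length [m] the running time is linear, at most [(2B+1)(m+1)+2], hence below [c*m + c]
   for this [c], and [x < 2 ^ x]. *)
exists (B.*2 + 3); split=> // phi; rewrite !map_id.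
have [t [tle H]] := tmachine_computes false in_var translate_out var_end (encode phi).
exists t; split; last by rewrite -tr_encode.
apply: leq_trans tle _; rewrite -/B -mulnSr.
apply: leq_trans (ltnW (ltn_expl _ (ltnSn 1))).
rewrite -addnn !mulnDl mulSn; move: (size _) {H} => m; move: (B * _) => x; lia.
Qed.

End TranslateWords.

Theorem theorem3p3 (n : nat) (n_ge1 : 1 <= n) (L_ : 'I_n -> logic 1)
    (L_T : forall i : 'I_n, i = 0 :> nat -> forall phi, L_ i phi <-> logic_T phi)
    (L_complete : forall i : 'I_n, i <> 0 :> nat -> kripke_complete (L_ i)) :
  exists f : form n -> form n,
    computable_in_exp_time f /\
    (forall phi : form n, at_most_one_var (f phi)) /\
    (forall phi : form n, product_logic L_ phi <-> product_logic L_ (f phi)).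
Proof.
exists (translate (Ordinal n_ge1)); split; first exact: translate_exp_time.
split=> phi; first exact: translate_at_most_one_var.
split; first exact: product_logic_translate.
by apply: translate_product_logic => psi; exact: L_T.
Qed.
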